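(* Let $(X,p)$ be a $p$-sequentially complete partial quasi-metric space. Then every $p$-Kannan mapping $T:X\to X$ on $(X,p)$, with constant $\lambda$ satisfying $0\leq\lambda<1/4$, has a unique fixed point $x^*\in X$, and $p(x^*,x^* )=0$.
   Context: A partial quasi-metric on a set $X$ is a function $p:X\times X\to[0,\infty)$ such that, for all $x,y,z\in X$: (1a) $p(x,x)\leq p(x,y)$; (1b) $p(x,x)\leq p(y,x)$; (2) $p(x,z)+p(y,y)\leq p(x,y)+p(y,z)$; (3) $x=y$ if and only if $p(x,x)=p(x,y)$ and $p(y,y)=p(y,x)$. The pair $(X,p)$ is then called a partial quasi-metric space. Define $p^+(x,y)=p(x,y)+p(y,x)$ for $x,y\in X$. A self-mapping $T:X\to X$ is called a $p$-Kannan mapping with constant $\lambda$, where $0\leq\lambda<1/4$, if $p(Tx,Ty)\leq\lambda\,[p(x,Tx)+p(y,Ty)]$ for all $x,y\in X$. Below, $\lim_{n,m\to\infty}$ denotes the simultaneous double limit (both $n$ and $m$ tend to infinity). A sequence $(x_n)_{n\geq1}$ in $X$ is $\tau(p^+)$-Cauchy if $\lim_{n,m\to\infty}p^+(x_n,x_m)$ exists and is finite. The space $(X,p)$ is $p$-sequentially complete if every $\tau(p^+)$-Cauchy sequence $(x_n)_{n\geq1}$ in $X$ is $\tau(p)$-convergent in the following sense: there exists $x\in X$ such that $\lim_{n,m\to\infty}p^+(x_n,x_m)=\lim_{n\to\infty}p(x,x_n)=p(x,x)$. *)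

(* Defs.v *)
From HB Require Import structures.
From mathcomp Require Import all_boot all_order all_algebra.
From mathcomp Require Import all_classical all_reals all_analysis.
Set Implicit Arguments.
Unset Strict Implicit.
Unset Printing Implicit Defensive.
Import Order.TTheory GRing.Theory Num.Theory.
Import numFieldNormedType.Exports.
Local Open Scope classical_set_scope.
Local Open Scope ring_scope.

Record partial_quasi_metric (R : realType) (X : Type) (p : X -> X -> R) : Prop :=
  PartialQuasiMetric {
    pqm_ge0 : forall x y, 0 <= p x y ;
    pqm_selfl : forall x y, p x x <= p x y ;
    pqm_selfr : forall x y, p x x <= p y x ;
    pqm_triangle : forall x y z, p x z + p y y <= p x y + p y z ;
    pqm_eq : forall x y, x = y <-> (p x x = p x y /\ p y y = p y x)
  }.

Definition pplus (R : realType) (X : Type) (p : X -> X -> R) (x y : X) : R :=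
  p x y + p y x.

(* The filter [(\oo, \oo)] on [nat * nat] is that of simultaneous double limits:
   both indices tend to infinity independently. *)
Definition pplus_lim (R : realType) (X : Type) (p : X -> X -> R)
    (u : nat -> X) (l : R) : Prop :=
  pplus p (u nm.1) (u nm.2) @[nm --> (\oo, \oo)] --> l.

(* The limit is finite because [l] ranges over [R]. *)
Definition pplus_cauchy (R : realType) (X : Type) (p : X -> X -> R)
    (u : nat -> X) : Prop :=
  exists l : R, pplus_lim p u l.

(* In [p x (u n)] the limit point is the first argument; [p] is not symmetric. *)
Definition p_seq_complete (R : realType) (X : Type) (p : X -> X -> R) : Prop :=
  forall u : nat -> X, pplus_cauchy p u ->
    exists x : X, pplus_lim p u (p x x) /\ p x (u n) @[n --> \oo] --> p x x.

Definition p_kannan (R : realType) (X : Type) (p : X -> X -> R)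
    (lambda : R) (T : X -> X) : Prop :=
  [/\ 0 <= lambda, lambda < 1 / 4 &
      forall x y, p (T x) (T y) <= lambda * (p x (T x) + p y (T y))].

(* Main.v *)
(** Along the Picard orbit the displacements [p (T^n x) (T^(n+1) x)] decay
    geometrically, so the orbit is Cauchy with limit [0], and completeness yields
    [x] with [p x x = 0] and [p x (T x) = 0].  Since [p] is not symmetric, this
    does not give [T x = x].  However, the Kannan inequality applied to the pairs
    [(x, T x)], [(T x, x)] bounds both [p (T x) (T (T x))] and [p (T (T x)) (T x)]
    by [0], so [T x] is the fixed point. *)
Require Import Defs.
From mathcomp Require Import all_boot all_order all_algebra.
From mathcomp Require Import all_classical all_reals all_analysis.
From mathcomp Require Import lra.
Import Order.TTheory GRing.Theory Num.Theory.
Import numFieldNormedType.Exports.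
Local Open Scope classical_set_scope.
Local Open Scope ring_scope.

Lemma pqm_eq0 (R : realType) (X : Type) (p : X -> X -> R) (x y : X) :
  partial_quasi_metric p -> p x y = 0 -> p y x = 0 -> x = y.
Proof.
move=> pp xy yx; apply/(pqm_eq pp); rewrite xy yx.
have := pqm_selfl pp x y; have := pqm_selfl pp y x.
have := pqm_ge0 pp x x; have := pqm_ge0 pp y y.
by rewrite xy yx => *; split; lra.
Qed.

Section Kannan.
Context {R : realType} {X : Type} {p : X -> X -> R} {lambda : R} {T : X -> X}.
Hypotheses (p_pqm : partial_quasi_metric p) (T_kannan : p_kannan p lambda T).

(** Replacing [lambda] by the constant 1/4 makes every later estimate linear in the values of [p],
    hence within reach of [lra]. *)
Lemma kannan_le_quarter (x y : X) :
  p (T x) (T y) <= 1 / 4 * (p x (T x) + p y (T y)).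
Proof.
have [_ l14 kT] := T_kannan; apply: (le_trans (kT x y)).
by apply: ler_wpM2r; [rewrite addr_ge0 // (pqm_ge0 p_pqm)|exact: ltW].
Qed.

(** Consecutive displacements satisfy a' <= (a + a') / 4, that is a' <= a / 3; hence the ratio
    1/3. *)
Lemma kannan_displacement_le (x : X) (n : nat) :
  p (iter n T x) (iter n.+1 T x) <= p x (T x) * (1 / 3) ^+ n.
Proof.
elim: n => [|n IHn] /=; first by rewrite expr0 mulr1.
have := kannan_le_quarter (iter n T x) (iter n.+1 T x).
by rewrite exprSr mulrA /= in IHn * => ?; lra.
Qed.

Lemma kannan_displacement_cvg0 (x : X) :
  p (iter n T x) (iter n.+1 T x) @[n --> \oo] --> 0.
Proof.
apply: (@squeeze_cvgr _ _ _ _ (fun=> 0) (geometric (p x (T x)) (1 / 3))).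
- apply: nearW => n; apply/andP; split; first exact: (pqm_ge0 p_pqm).
  exact: kannan_displacement_le.
- exact: cvg_cst.
- by apply: cvg_geometric; rewrite ger0_norm; lra.
Qed.

(** The orbit starts at [T x], so that both arguments of [p] are images under [T]; the two Kannan
    bounds then add up to (a n + a m) / 2. *)
Lemma kannan_orbit_pplus_lim (x : X) :
  pplus_lim p (fun n => iter n.+1 T x) 0.
Proof.
have a0 := kannan_displacement_cvg0 x.
pose a n := p (iter n T x) (iter n.+1 T x).
apply: (@squeeze_cvgr _ _ _ _ (fun=> 0) (fun nm : nat * nat => a nm.1 + a nm.2)).
- apply: nearW => -[n m] /=; rewrite /pplus addr_ge0 ?(pqm_ge0 p_pqm) //=.
  have := kannan_le_quarter (iter n T x) (iter m T x).
  have := kannan_le_quarter (iter m T x) (iter n T x).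
  have := pqm_ge0 p_pqm (iter n T x) (iter n.+1 T x).
  have := pqm_ge0 p_pqm (iter m T x) (iter m.+1 T x).
  by rewrite /a /= => *; lra.
- exact: cvg_cst.
- rewrite -[X in _ --> X](addr0 (0 : R)); apply: cvgD.
  + exact: (cvg_comp _ _ cvg_fst a0).
  + exact: (cvg_comp _ _ cvg_snd a0).
Qed.

Lemma kannan_orbit_limit_displacement (x y : X) :
  p x (iter n.+1 T y) @[n --> \oo] --> 0 -> p x (T x) = 0.
Proof.
move=> xu; have a0 := kannan_displacement_cvg0 y.
have := pqm_ge0 p_pqm x (T x).
(* The triangle inequality through [iter n.+1 T y] leaves a term that the Kannan bound controls by a
   quarter of [p x (T x)] plus a vanishing displacement; absorbing that quarter leaves 3/4. *)
suff: 3 / 4 * p x (T x) <= 0 by move=> *; lra.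
have s0 : p x (iter n.+1 T y) + p (iter n T y) (iter n.+1 T y)
    @[n --> \oo] --> (0 + 0 : R) by exact: cvgD.
rewrite -[leRHS](addr0 (0 : R)) -(cvg_lim (@Rhausdorff R) s0).
apply: limr_ge; first by apply/cvg_ex; exists (0 + 0).
apply: nearW => n /=.
have := kannan_le_quarter (iter n T y) x.
have := pqm_triangle p_pqm x (iter n.+1 T y) (T x).
have := pqm_ge0 p_pqm (iter n.+1 T y) (iter n.+1 T y).
have := pqm_ge0 p_pqm (iter n T y) (iter n.+1 T y).
by move=> /= *; lra.
Qed.

Lemma kannan_fixed_of_displacement0 (x : X) :
  p x (T x) = 0 -> T (T x) = T x.
Proof.
move=> d0.
have := kannan_le_quarter x (T x); have := kannan_le_quarter (T x) x.
have := pqm_ge0 p_pqm (T x) (T (T x)); have := pqm_ge0 p_pqm (T (T x)) (T x).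
by rewrite d0 => *; apply: (pqm_eq0 _ _ _ _ _ p_pqm); lra.
Qed.

(** At a fixed point the Kannan bound reads p x x <= (p x x) / 2. *)
Lemma kannan_fixed_self0 (x : X) : T x = x -> p x x = 0.
Proof.
move=> Tx; have := kannan_le_quarter x x; have := pqm_ge0 p_pqm x x.
by rewrite Tx => *; lra.
Qed.

Lemma kannan_fixed_unique (x y : X) : T x = x -> T y = y -> x = y.
Proof.
move=> Tx Ty.
have := kannan_le_quarter x y; have := kannan_le_quarter y x.
have := pqm_ge0 p_pqm x y; have := pqm_ge0 p_pqm y x.
(* The displacements of fixed points are their self-distances, which vanish, so [p x y] and [p y x]
   are both bounded by 0. *)
rewrite Tx Ty !kannan_fixed_self0 // => *.
by apply: (pqm_eq0 _ _ _ _ _ p_pqm); lra.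
Qed.

End Kannan.

Theorem theorem2p3 (R : realType) (X : Type) (p : X -> X -> R)
    (X_nonempty : inhabited X)
    (p_pqm : partial_quasi_metric p)
    (p_complete : p_seq_complete p)
    (lambda : R) (T : X -> X) (T_kannan : p_kannan p lambda T) :
  exists xstar : X, unique (fun x : X => T x = x) xstar /\ p xstar xstar = 0.
Proof.
have [y] := X_nonempty.
have u0 := kannan_orbit_pplus_lim p_pqm T_kannan y.
have [x [ux xu]] := p_complete _ (ex_intro _ 0 u0).
(* Completeness makes [p x x] the double limit of the orbit, already known to be 0. *)
have xx0 : p x x = 0 := cvg_unique (@Rhausdorff R) ux u0.
rewrite xx0 in xu.
have TTx := kannan_fixed_of_displacement0 p_pqm T_kannan _
  (kannan_orbit_limit_displacement p_pqm T_kannan _ _ xu).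
exists (T x); split; last exact: (kannan_fixed_self0 p_pqm T_kannan).
by split=> // z Tz; exact: (kannan_fixed_unique p_pqm T_kannan).
Qed.
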